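(* Let $\xi_1,\xi_2,\ldots$ be independent identically distributed real random variables with common subexponential distribution $F$ on ${\bf R}$ (a finite mean is not assumed), and let $\tau$ be a counting random variable that does not depend on the future of the sequence $\{\xi_n\}$. If $\tau$ is bounded (i.e. ${\bf P}\{\tau\le N\}=1$ for some $N$), then $$ {\bf P}\{S_\tau>x\}\sim{\bf E}\tau\,\overline F(x)\quad\text{as }x\to\infty, $$ that is, ${\bf P}\{S_\tau>x\}/\overline F(x)\to{\bf E}\tau$.
   Context: $\overline F(x)={\bf P}\{\xi_1>x\}$, $S_0=0$, $S_n=\xi_1+\cdots+\xi_n$. A counting random variable is a random variable with values in $\{0,1,2,\ldots\}$; $S_\tau$ is $S_n$ evaluated at the random index $n=\tau$. A distribution $G$ on ${\bf R}^+=[0,\infty)$ with unbounded support is subexponential if $\overline{G*G}(x)/\overline G(x)\to2$ as $x\to\infty$, where $\overline G(x)=G((x,\infty))$. A distribution $F$ on ${\bf R}$ is subexponential if its conditional distribution on ${\bf R}^+$ (i.e. $F(\cdot\cap{\bf R}^+)/F({\bf R}^+)$) is subexponential. A counting random variable $\tau$ does not depend on the future of the sequence $\{\xi_n\}$ if, for every $n\ge0$, the family $(\xi_1,\ldots,\xi_n,{\bf I}\{\tau\le n\})$ is independent of the family $(\xi_j,\ j\ge n+1)$ (for $n=0$ this says that ${\bf I}\{\tau\le0\}$ is independent of $(\xi_j,\ j\ge1)$). *)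

(* Defs.v *)
From HB Require Import structures.
From mathcomp Require Import all_boot all_order all_algebra finmap.
From mathcomp Require Import all_classical all_reals all_analysis.

Set Implicit Arguments.
Unset Strict Implicit.
Unset Printing Implicit Defensive.
Import Order.TTheory GRing.Theory Num.Theory numFieldNormedType.Exports.

Local Open Scope classical_set_scope.
Local Open Scope ring_scope.
Local Open Scope ereal_scope.

Definition tail {R : realType} (G : set R -> \bar R) (x : R) : \bar R :=
  G `]x, +oo[%classic.

Definition convolution {R : realType}
    (G H : probability (measurableTypeR R) R) : set R -> \bar R :=
  pushforward (G \x H) (fun p : measurableTypeR R * measurableTypeR R =>
    (p.1 + p.2)%R : measurableTypeR R).

(* Topological support: the points all of whose neighbourhoods are charged. *)
Definition support_of {R : realType} (G : set R -> \bar R) : set R :=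
  [set x | forall U : set R, open_nbhs x U -> 0 < G U].

Definition subexponential_pos {R : realType}
    (G : probability (measurableTypeR R) R) : Prop :=
  [/\ G `[0%R, +oo[%classic = 1,
      ~ bounded_set (support_of G) &
      tail (convolution G G) x / tail G x @[x --> +oo%R] --> 2%:E].

(* The conditional distribution of [F] on [0, +oo[.  [mnormalize] divides by
   the total mass; its last argument is the value returned when that mass is
   0, a case excluded by [subexponential]. *)
Definition cond_pos {R : realType} (F : probability (measurableTypeR R) R) :
    probability (measurableTypeR R) R :=
  mnormalize (mrestr F (measurable_itv `[0%R, +oo[)) F.

Definition subexponential {R : realType}
    (F : probability (measurableTypeR R) R) : Prop :=
  0 < F `[0%R, +oo[%classic /\ subexponential_pos (cond_pos F).

Section independence.
Context {d : measure_display} {T : measurableType d} {R : realType}.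
Variable P : probability T R.

Definition mutually_independent (xi : nat -> {RV P >-> R}) : Prop :=
  forall (J : {fset nat}) (A : nat -> set R),
    (forall i, measurable (A i)) ->
    P (\bigcap_(i in [set` J]) (xi i @^-1` A i)) =
    \prod_(i <- J) P (xi i @^-1` A i).

Definition independent_systems (G H : set (set T)) : Prop :=
  forall A B, G A -> H B -> P (A `&` B) = P A * P B.

(* Throughout, [xi i] stands for the variable usually numbered i + 1, so that
   [xi 0, ..., xi (n - 1)] are the first n variables. *)
Definition past (xi : nat -> {RV P >-> R}) (tau : {RV P >-> nat}) (n : nat) :
    set (set T) :=
  <<s (\bigcup_(i in [set i | (i < n)%N]) g_sigma_algebra_preimage (xi i)) `|`
      g_sigma_algebra_preimage (\1_[set w | (tau w <= n)%N] : T -> R) >>.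

Definition future (xi : nat -> {RV P >-> R}) (n : nat) : set (set T) :=
  <<s \bigcup_(i in [set i | (n <= i)%N]) g_sigma_algebra_preimage (xi i) >>.

Definition independent_of_future
    (xi : nat -> {RV P >-> R}) (tau : {RV P >-> nat}) : Prop :=
  forall n, independent_systems (past xi tau n) (future xi n).

Definition partial_sum (xi : nat -> {RV P >-> R}) (n : nat) (w : T) : R :=
  (\sum_(i < n) xi i w)%R.

End independence.

(* Main.v *)
Require Import Defs.
From HB Require Import structures.
From mathcomp Require Import all_boot all_order all_algebra.
From mathcomp Require Import all_classical all_reals all_analysis.
From mathcomp Require Import measurable_realfun ring lra.

Set Implicit Arguments.
Unset Strict Implicit.
Unset Printing Implicit Defensive.
Import Order.TTheory GRing.Theory Num.Theory numFieldNormedType.Exports.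

Local Open Scope classical_set_scope.
Local Open Scope ring_scope.

(** Write [Fb] for the tail of [F]. The theorem is an instance of the principle
    of a single big jump: up to events of probability [o(Fb x)], the stopped sum
    exceeds [x] exactly when one of the summands that are actually used, that is
    [xi i] with [i < tau], exceeds [x] by itself. Given this, the theorem is a
    count: [i < tau] belongs to the past at time [i], so it is independent of
    [xi i] and [P(x < xi i, i < tau) = P(i < tau) Fb x]; two jumps at once cost
    [Fb x ^ 2]; and the sum over [i] of [P(i < tau)] is the mean of [tau].

    The error events are estimated for each fixed number [n] of summands,
    whatever the dependence on [tau], and a bounded [tau] leaves finitely many
    [n]. There are two kinds of error.

    - A sum exceeds [x] although no summand does. Replacing summands by their
      positive parts only enlarges this event, and [vanishing_pos_sum_below]
      shows by induction on [n] that it has probability [o(Fb x)]. For [n = 2]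
      this is a reformulation of subexponentiality ([vanishing_pair_below]). For
      the induction step let [V] be the sum of the first [n] positive parts and
      [Y] the next variable, with [V <= x], [Y <= x] and [x < V + Y]. If
      [Y <= a], then [V] lies in the window [(x - a, x]], which is negligible
      because [F] is long-tailed ([vanishing_tail_window]). If [a < Y], then [V]
      may be replaced by a single variable at the price of a constant factor
      ([convolution_tail_le]), since the tail of [V] is at most a multiple of
      [Fb] by the induction hypothesis; this leads back to [n = 2], apart from
      the event that both variables are large, of probability [Fb a * Fb x],
      where [a] is at our disposal.

    - A summand exceeds [x] but the stopped sum does not. Then either the summand
      lies in a window just above [x], negligible by long-tailedness, or some
      other variable is very negative, which has a small probability and is
      independent of the jump ([stopped_tail_ge]). *)

(** * Probabilities of boolean events *)

(** Probabilities are handled as real numbers and events as boolean predicates,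
    so that inclusions of events and estimates of probabilities both become
    problems of linear arithmetic. *)
Definition pr {d : measure_display} {T : measurableType d} {R : realType}
  (P : set T -> \bar R) (E : T -> bool) : R := fine (P [set w | E w]).

Section events.
Context {d : measure_display} {T : measurableType d}.

Lemma measurable_event (E : T -> bool) :
  measurable_fun setT E -> measurable [set w | E w].
Proof.
move=> mE; rewrite -[X in measurable X]setTI.
exact: (mE measurableT [set true]).
Qed.

Lemma measurable_all {I : Type} (s : seq I) (E : I -> T -> bool) :
  (forall i, measurable_fun setT (E i)) ->
  measurable_fun setT (fun w => all (E^~ w) s).
Proof.
move=> mE; elim: s => [|i s IHs] /=; first exact: measurable_cst.
exact: measurable_and.
Qed.

Lemma measurable_has {I : Type} (s : seq I) (E : I -> T -> bool) :
  (forall i, measurable_fun setT (E i)) ->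
  measurable_fun setT (fun w => has (E^~ w) s).
Proof.
move=> mE; elim: s => [|i s IHs] /=; first exact: measurable_cst.
exact: measurable_or.
Qed.

End events.

Ltac solve_meas := repeat first
  [ solve [trivial]
  | exact: measurable_cst
  | exact: measurable_funPT
  | apply: measurable_and
  | apply: measurable_or
  | apply: measurable_neg
  | apply: measurable_all => ?
  | apply: measurable_has => ?
  | apply: measurable_fun_ltr
  | apply: measurable_fun_ler
  | apply: measurable_funD
  | apply: measurable_funB
  | apply: measurable_maxr
  | apply: measurable_sum => ? ].

Section event_calculus.
Context {d : measure_display} {T : measurableType d} {R : realType}.
Variable P : probability T R.
Implicit Types E G : T -> bool.

Lemma pr_ge0 E : 0 <= pr P E.
Proof. exact/fine_ge0/measure_ge0. Qed.

Lemma prE E : measurable_fun setT E -> P [set w | E w] = (pr P E)%:E.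
Proof.
by move=> /measurable_event mE; rewrite /pr fineK// fin_num_measure.
Qed.

Lemma le_pr E G : measurable_fun setT E -> measurable_fun setT G ->
  (forall w, E w -> G w) -> pr P E <= pr P G.
Proof.
move=> mE mG EG; rewrite -lee_fin -!prE//.
by apply: le_measure; rewrite ?inE//; exact: measurable_event.
Qed.

Lemma pr_le1 E : measurable_fun setT E -> pr P E <= 1.
Proof.
by move=> mE; rewrite -lee_fin -prE// probability_le1//; exact: measurable_event.
Qed.

Lemma eq_pr E G : E =1 G -> pr P E = pr P G.
Proof. by move=> /funext ->. Qed.

Lemma prID E G : measurable_fun setT E -> measurable_fun setT G ->
  pr P E = pr P (fun w => E w && G w) + pr P (fun w => E w && ~~ G w).
Proof.
move=> mE mG; apply: EFin_inj; rewrite EFinD -!prE; [|solve_meas..].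
rewrite -measureU//; [|apply: measurable_event; solve_meas..|].
  congr (P _); apply/seteqP; split => w /=.
    by move=> Ew; case: (boolP (G w)); [left|right]; rewrite Ew.
  by case=> /andP[].
by apply/seteqP; split => w //= -[/andP[_ Gw]]; rewrite Gw andbF.
Qed.

Lemma pr_neg E : measurable_fun setT E -> pr P (fun w => ~~ E w) = 1 - pr P E.
Proof.
move=> mE; have := prID (E:= fun=> true) (G:=E) (measurable_cst _) mE.
rewrite [X in X = _](_ : _ = 1); last first.
  rewrite /pr (_ : [set _ | _] = setT) ?probability_setT//.
  by apply/seteqP; split.
by move=> /= ->; rewrite addrAC subrr add0r.
Qed.

(** Boole's inequality. *)
Lemma pr_cover {I : Type} (s : seq I) (A : I -> T -> bool) E :
  measurable_fun setT E -> (forall i, measurable_fun setT (A i)) ->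
  (forall w, E w -> has (A^~ w) s) -> pr P E <= \sum_(i <- s) pr P (A i).
Proof.
move=> mE mA; elim: s => [|i s IHs] in E mE *.
  move=> E0; rewrite big_nil (_ : E = fun=> false).
    by rewrite /pr (_ : [set _ | _] = set0) ?measure0//; apply/seteqP; split.
  by apply/funext => w; apply/negP => /E0.
move=> Es; rewrite big_cons (prID mE (mA i))// lerD//.
  by apply: le_pr; [solve_meas..|move=> w /andP[]].
apply: IHs; first by solve_meas.
by move=> w /andP[/Es/=]; case: (A i w).
Qed.

Lemma pr_cover2 E A B :
  measurable_fun setT E -> measurable_fun setT A -> measurable_fun setT B ->
  (forall w, E w -> A w || B w) -> pr P E <= pr P A + pr P B.
Proof.
move=> mE mA mB EAB.
have := @pr_cover _ [:: true; false] (fun b => if b then A else B) E mE.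
rewrite !big_cons big_nil addr0; apply; first by case.
by move=> w /EAB /=; rewrite orbF.
Qed.

(** The lower Bonferroni inequality for a union, which [E] contains. It is what
    replaces disjointness of the jumps: their overlaps are of smaller order. *)
Lemma pr_bonferroni (n : nat) (A : nat -> T -> bool) E :
  measurable_fun setT E -> (forall i, measurable_fun setT (A i)) ->
  (forall i w, (i < n)%N -> A i w -> E w) ->
  \sum_(i < n) pr P (A i) <=
    pr P E + \sum_(j < n) \sum_(i < j) pr P (fun w => A i w && A j w).
Proof.
move=> mE mA; elim: n => [|n IHn] in E mE *.
  by move=> _; rewrite !big_ord0 addr0 pr_ge0.
move=> AE; rewrite !big_ord_recr /=.
pose U w := has (A^~ w) (iota 0 n).
have mU : measurable_fun setT U by exact: measurable_has.
have AU i w : (i < n)%N -> A i w -> U w.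
  by move=> ni Aiw; apply/hasP; exists i => //; rewrite mem_iota.
have {IHn} := IHn U mU AU.
have : pr P (fun w => A n w && U w) <= \sum_(i < n) pr P (fun w => A i w && A n w).
  rewrite -(big_mkord xpredT (fun i => pr P (fun w => A i w && A n w))).
  rewrite /index_iota subn0; apply: pr_cover => [|i|w]; [by solve_meas..|].
  move=> /andP[Anw /hasP[i si Aiw]]; apply/hasP; exists i => //.
  exact/andP.
have := prID (mA n) mU.
have := prID mE mU.
have : pr P U <= pr P (fun w => E w && U w).
  apply: le_pr; [solve_meas..|] => w Uw; rewrite Uw andbT.
  have /hasP[i] := Uw; rewrite mem_iota => /= ni; apply: AE.
  exact: ltnW.
have : pr P (fun w => A n w && ~~ U w) <= pr P (fun w => E w && ~~ U w).
  apply: le_pr; [solve_meas; exact: mA|solve_meas|] => w /andP[Anw ->]; rewrite andbT.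
  exact: (AE n).
lra.
Qed.

End event_calculus.

(** * Negligible functions at infinity *)

(** One-sided on purpose: [f] is only bounded from above, so that upper bounds
    of [f] by a negligible function transfer to [f]. *)
Definition vanishing_wrt {R : realType} (g f : R -> R) : Prop :=
  forall e : R, 0 < e -> \forall x \near +oo, f x <= e * g x.

Section vanishing_theory.
Context {R : realType}.
Implicit Types f g h : R -> R.

Lemma vanishing_le g f h :
  (\forall x \near +oo, f x <= h x) -> vanishing_wrt g h -> vanishing_wrt g f.
Proof.
move=> fh hg e e0; near=> x.
by apply: (@le_trans _ _ (h x)); near: x; [exact: fh|exact: hg].
Unshelve. all: by end_near. Qed.

Lemma vanishingD g f h :
  vanishing_wrt g f -> vanishing_wrt g h -> vanishing_wrt g (fun x => f x + h x).
Proof.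
move=> fg hg e e0; have e2 : 0 < e / 2 by rewrite divr_gt0.
have := fg _ e2; have := hg _ e2; apply: filterS2 => x.
lra.
Qed.

Lemma vanishingZ (c : R) g f :
  0 < c -> vanishing_wrt g f -> vanishing_wrt g (fun x => c * f x).
Proof.
move=> c0 fg e e0; have := fg (e / c); rewrite divr_gt0// => /(_ isT).
apply: filterS => x; rewrite -(ler_pM2l c0) => /le_trans; apply.
by rewrite mulrA mulrCA divff ?mulr1// gt_eqF.
Qed.

Lemma vanishing_sum {I : Type} (s : seq I) g (f : I -> R -> R) :
  (forall x, 0 <= g x) -> (forall i, vanishing_wrt g (f i)) ->
  vanishing_wrt g (fun x => \sum_(i <- s) f i x).
Proof.
move=> g0 fg; elim: s => [|i s IHs].
  by move=> e e0; near=> x; rewrite big_nil mulr_ge0// ltW.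
apply: (vanishing_le _ (vanishingD (fg i) IHs)).
by near=> x; rewrite big_cons.
Unshelve. all: by end_near. Qed.

(** The form in which a free parameter (a truncation level) is eliminated: an
    arbitrarily small multiple of [g] may be left over. *)
Lemma vanishing_approx g f :
  (forall e, 0 < e -> exists2 h, vanishing_wrt g h &
    \forall x \near +oo, f x <= e * g x + h x) -> vanishing_wrt g f.
Proof.
move=> fP e e0; have e2 : 0 < e / 2 by rewrite divr_gt0.
have [h /(_ _ e2) hg] := fP _ e2; move: hg; apply: filterS2 => x; lra.
Qed.

Lemma near_pinfty_subr (a : R) (Q : R -> Prop) :
  (\forall x \near +oo, Q x) -> \forall x \near +oo, Q (x - a).
Proof.
move=> [M [_ MQ]]; exists (M + a); split; first exact: num_real.
by move=> x Mx; apply: MQ; rewrite ltrBrDr.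
Qed.

End vanishing_theory.

(** * Comparison of convolutions *)

Section joint_law.
Context {d : measure_display} {T : measurableType d} {R : realType}.
Variable P : probability T R.
Variable F : probability (measurableTypeR R) R.
Local Open Scope ereal_scope.

(** Condition on the value [y] of [Y]: the other variable then has to exceed
    [x - y], which is nonnegative since [y <= x], so that the tails of [V] and
    [V'] are only compared where they are assumed comparable. *)
Lemma convolution_tail_le (V V' Y Y' : T -> R) (C a x : R) :
  measurable_fun setT V -> measurable_fun setT V' ->
  measurable_fun setT Y -> measurable_fun setT Y' -> (0 <= C)%R ->
  (forall A B : set R, measurable A -> measurable B ->
    P [set w | A (Y w) /\ B (V w)] = F A * P [set w | B (V w)]) ->
  (forall A B : set R, measurable A -> measurable B ->
    P [set w | A (Y' w) /\ B (V' w)] = F A * P [set w | B (V' w)]) ->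
  (forall z : R, 0 <= z ->
    pr P (fun w => z < V w) <= C * pr P (fun w => z < V' w))%R ->
  (pr P (fun w => (a < Y w <= x) && (x < Y w + V w)) <=
    C * pr P (fun w => (a < Y' w <= x) && (x < Y' w + V' w)))%R.
Proof.
move=> mV mV' mY mY' C0 VY VY' le_tail.
pose S : set (measurableTypeR R * measurableTypeR R) :=
  [set p | ((a < p.1 <= x) && (x < p.1 + p.2))%R].
have mS : measurable S.
  have m1 : measurable_fun setT (fst : measurableTypeR R * measurableTypeR R -> R).
    exact: measurable_fst.
  have m2 : measurable_fun setT (snd : measurableTypeR R * measurableTypeR R -> R).
    exact: measurable_snd.
  by apply: measurable_event; solve_meas.
(* the joint law is the product of the marginals, so Fubini applies *)
have joint (U W : T -> R) : measurable_fun setT U -> measurable_fun setT W ->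
    (forall A B : set R, measurable A -> measurable B ->
      P [set w | A (W w) /\ B (U w)] = F A * P [set w | B (U w)]) ->
    measurable_fun setT (fun y : measurableTypeR R =>
      P [set w | ((a < (y : R) <= x) && (x < (y : R) + U w))%R]) /\
    (pr P (fun w => (a < W w <= x) && (x < W w + U w)))%:E =
    \int[F]_y P [set w | ((a < (y : R) <= x) && (x < (y : R) + U w))%R].
  move=> mU mW UW.
  have mUR : measurable_fun setT (U : T -> measurableTypeR R) by exact: mU.
  pose U' : {mfun T >-> measurableTypeR R} :=
    HB.pack (U : T -> measurableTypeR R) (isMeasurableFun.Build _ _ _ _ _ mUR).
  have mWU : measurable_fun setT
      (fun w => (W w, U w) : measurableTypeR R * measurableTypeR R).
    exact: measurable_fun_pair.
  pose WU : {mfun T >-> (measurableTypeR R * measurableTypeR R)%type} :=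
    HB.pack (fun w => (W w, U w) : measurableTypeR R * measurableTypeR R)
     (isMeasurableFun.Build _ _ _ _ _ mWU).
  have sectE : distribution P U' \o xsection S =
      fun y => P [set w | ((a < (y : R) <= x) && (x < (y : R) + U w))%R].
    apply/funext => y /=; congr (P _); apply/seteqP.
    by split => w /=; rewrite /xsection/= inE.
  split; first by rewrite -sectE; exact: measurable_fun_xsection.
  have := @product_measure_unique _ _ _ _ _ F (distribution P U')
    (distribution P WU) UW S mS.
  rewrite /product_measure1 sectE => ->.
  by rewrite -prE//; solve_meas.
rewrite -lee_fin EFinM; have [mI ->] := joint _ _ mV mY VY.
have [mI' ->] := joint _ _ mV' mY' VY'.
rewrite -ge0_integralZl//.
apply: ge0_le_integral => //.
- exact: measurable_funeM.
- move=> y _; have mlt (U : T -> R) : measurable_fun setT U ->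
      measurable_fun setT (fun w => x < (y : R) + U w)%R by move=> ?; solve_meas.
  have [/= ayx|_] := boolP (a < (y : R) <= x)%R; last first.
    by rewrite (_ : [set _ | _] = set0) ?measure0 ?mule_ge0// -subset0.
  rewrite !prE; [|exact: mlt..].
  rewrite -EFinM lee_fin; have := le_tail (x - y)%R.
  rewrite subr_ge0; case/andP: ayx => _ -> /(_ isT).
  rewrite [X in (X <= _)%R](@eq_pr _ _ _ _ _ (fun w => x < (y : R) + V w)%R).
    rewrite [X in (_ <= _ * X)%R](@eq_pr _ _ _ _ _ (fun w => x < (y : R) + V' w)%R)//.
    by move=> w; rewrite ltrBlDl.
  by move=> w; rewrite ltrBlDl.
Qed.

End joint_law.

(** * The tail of a subexponential distribution *)

(** [measurableTypeR R] has to be named: by unification alone a predicate on [R]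
    is not read as an event of the probability space carrying [F]. *)
Local Notation prR := (@pr _ (measurableTypeR _) _).

Definition tailr {R : realType} (F : set R -> \bar R) (x : R) : R :=
  prR F (fun y : R => x < y).

Section subexponential_tail.
Context {R : realType}.
Variable F : probability (measurableTypeR R) R.
Hypothesis F_subexp : subexponential F.

Let p : R := prR F (fun y : R => 0 <= y).

Lemma measurable_idR : measurable_fun setT (fun y : measurableTypeR R => y : R).
Proof. exact: measurable_id. Qed.

#[local] Hint Resolve measurable_idR : core.

Lemma tailrE x : tail F x = (tailr F x)%:E.
Proof.
rewrite /tail set_itvE; apply: prE.
by apply: measurable_fun_ltr => //; exact: measurable_cst.
Qed.

Lemma measurable_gt x :
  measurable_fun setT (fun y : measurableTypeR R => x < (y : R)).
Proof. by apply: measurable_fun_ltr => //; exact: measurable_cst. Qed.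

Lemma measurable_ge x :
  measurable_fun setT (fun y : measurableTypeR R => x <= (y : R)).
Proof. by apply: measurable_fun_ler => //; exact: measurable_cst. Qed.

Lemma tailr_window x y : x <= y ->
  prR F (fun z : R => (x < z) && ~~ (y < z)) = tailr F x - tailr F y.
Proof.
move=> xy; have /eqP := prID F (measurable_gt x) (measurable_gt y).
have -> : prR F (fun z : R => (x < z) && (y < z)) = tailr F y.
  by apply: eq_pr => z; rewrite andb_idl// => /(le_lt_trans xy).
by rewrite addrC -subr_eq eq_sym => /eqP.
Qed.

Lemma tailr_ge0 x : 0 <= tailr F x. Proof. exact: pr_ge0. Qed.

Lemma tailr_le x y : x <= y -> tailr F y <= tailr F x.
Proof.
move=> xy; apply: le_pr; [solve_meas; exact: measurable_idR..|] => w.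
exact: le_lt_trans.
Qed.

Lemma tailr_cvg0 (e : R) : 0 < e -> \forall x \near +oo, tailr F x <= e.
Proof.
move=> e0; pose X : {RV F >-> R} :=
  HB.pack (fun y : measurableTypeR R => y : R)
    (isMeasurableFun.Build _ _ _ _ _ measurable_idR).
have /fine_cvgP[_ /cvgrPdist_le/(_ _ e0)] := cvg_ccdfy0 X.
apply: filterS => x /=; rewrite sub0r normrN ger0_norm ?fine_ge0//.
have -> : ccdf X x = tail F x by [].
by rewrite tailrE.
Qed.

Lemma left_tail_small (e : R) : 0 < e -> exists2 a : R, 0 <= a &
  prR F (fun y : R => y < - a) <= e.
Proof.
move=> e0; pose X : {RV F >-> R} :=
  HB.pack (fun y : measurableTypeR R => y : R)
    (isMeasurableFun.Build _ _ _ _ _ measurable_idR).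
have /fine_cvgP[_ /cvgrPdist_le/(_ _ e0)[M [_ FM]]] := cvg_cdfNy0 X.
exists (Num.max (1 - M) 0); first by rewrite le_max lexx orbT.
have mcdf r : fine (cdf X r) = prR F (fun y : R => y <= r).
  by rewrite /cdf /distribution /pushforward set_itvE.
have := FM (- Num.max (1 - M) 0); rewrite /= sub0r normrN ger0_norm ?fine_ge0//.
rewrite mcdf => /(_ _)/(le_trans _); apply; last first.
  by rewrite ltrNl lt_max; apply/orP; left; lra.
apply: le_pr => [||y /ltW//].
- by apply: measurable_fun_ltr => //; exact: measurable_cst.
- by apply: measurable_fun_ler => //; exact: measurable_cst.
Qed.

Lemma nonneg_massE : F `[0, +oo[%classic = p%:E.
Proof.
rewrite set_itvE; apply: prE.
by apply: measurable_fun_ler => //; exact: measurable_cst.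
Qed.

Lemma nonneg_mass_gt0 : 0 < p.
Proof. by have [+ _] := F_subexp; rewrite nonneg_massE lte_fin. Qed.

Lemma cond_posE (A : set R) :
  cond_pos F A = (F (A `&` [set y | 0 <= y]%R) * p^-1%:E)%E.
Proof.
rewrite /cond_pos /= /mnormalize /= /mrestr setTI nonneg_massE.
by rewrite eqe gt_eqF ?nonneg_mass_gt0//= set_itvE.
Qed.

Lemma tail_cond_pos x : 0 <= x -> tail (cond_pos F) x = (tailr F x / p)%:E.
Proof.
move=> x0; rewrite /tail cond_posE EFinM -tailrE /tail; congr (F _ * _)%E.
apply/seteqP; split => y /=; rewrite in_itv/= andbT.
  by move=> [xy _]; exact: xy.
by move=> xy; split; [exact: xy|exact: le_trans x0 (ltW xy)].
Qed.

(** The support lies in [0, +oo[, because the negative half-line is an open set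
    without mass; a point beyond which there is no mass would bound it. *)
Lemma tailr_gt0 x : 0 < tailr F x.
Proof.
rewrite lt_neqAle tailr_ge0 andbT; apply/eqP => /esym Fx0.
have [_ [_ + _]] := F_subexp; apply.
have [M M0 xM] : exists2 M, 0 <= M & x <= M.
  by exists (Num.max x 0); rewrite le_max lexx ?orbT.
have {}Fx0 : tailr F M = 0.
  by apply/eqP; rewrite eq_le tailr_ge0 -Fx0 tailr_le.
exists M; split; first exact: num_real.
move=> m Mm y /= yG; apply: ltW; apply: le_lt_trans Mm.
rewrite leNgt; apply/negP; rewrite ltr_normr => /orP[My|My].
- have : (0 < tail (cond_pos F) M)%E.
    rewrite /tail; apply: yG; split; last by rewrite /= in_itv/= My.
    by rewrite set_itvE; exact: open_gt.
  by rewrite tail_cond_pos// Fx0 mul0r ltxx.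
- have : (0 < cond_pos F [set z | (z < 0)%R])%E.
    apply: yG; split; first exact: open_lt.
    by rewrite /= -oppr_gt0 (le_lt_trans M0).
  rewrite cond_posE (_ : _ `&` _ = set0) ?measure0 ?mul0e ?ltxx//.
  by apply/seteqP; split => // z []/= z0; rewrite leNgt z0.
Qed.

Section pair.
Context {d : measure_display} {T : measurableType d}.
Variable P : probability T R.
Variables X Y : T -> R.
Hypothesis mX : measurable_fun setT X.
Hypothesis mY : measurable_fun setT Y.
Hypothesis XY : forall A B : set R, measurable A -> measurable B ->
  P [set w | A (X w) /\ B (Y w)] = (F A * F B)%E.

(** The product of the conditional laws is the law of [(X, Y)] restricted to the
    event that both variables are nonnegative, and normalized: both measures
    agree on rectangles. *)
Lemma tail_convolution_cond_pos x :
  tail (convolution (cond_pos F) (cond_pos F)) x =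
  (pr P (fun w => [&& 0 <= X w, 0 <= Y w & x < X w + Y w]) / p ^+ 2)%:E.
Proof.
have mXY : measurable_fun setT
    (fun w => (X w, Y w) : measurableTypeR R * measurableTypeR R).
  exact: measurable_fun_pair.
pose XY' : {mfun T >-> (measurableTypeR R * measurableTypeR R)%type} :=
  HB.pack (fun w => (X w, Y w) : measurableTypeR R * measurableTypeR R)
   (isMeasurableFun.Build _ _ _ _ _ mXY).
pose D := [set w | (0 <= X w) && (0 <= Y w)].
have mD : measurable D by apply: measurable_event; solve_meas.
have p0 := nonneg_mass_gt0.
have k0 : 0 <= p^-1 ^+ 2 by rewrite exprn_ge0// invr_ge0 ltW.
pose m' := pushforward (mscale (NngNum k0) (mrestr P mD)) XY'.
have m1 : measurable_fun setT (fst : measurableTypeR R * measurableTypeR R -> R).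
  exact: measurable_fst.
have m2 : measurable_fun setT (snd : measurableTypeR R * measurableTypeR R -> R).
  exact: measurable_snd.
have -> : tail (convolution (cond_pos F) (cond_pos F)) x =
    (cond_pos F \x cond_pos F)%E [set q | x < q.1 + q.2].
  rewrite /tail /convolution /pushforward; congr ((_ \x _)%E _).
  by apply/seteqP; split => q /=; rewrite in_itv/= andbT.
rewrite (@product_measure_unique _ _ _ _ _ (cond_pos F) (cond_pos F) m').
- rewrite /m' /pushforward/= /mscale/= /mrestr.
  rewrite [RHS]EFinM -prE; last by solve_meas.
  rewrite [RHS]muleC -exprVn.
  congr (_ * P _)%E; apply/seteqP; split => w /=; rewrite /D/=.
    by case=> -> /andP[-> ->].
  by case/and3P => -> -> ->.
- move=> A B mA mB.
  transitivity (cond_pos F A * cond_pos F B)%E; last by [].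
  rewrite !cond_posE muleACA -XY; last 2 first.
  + by apply: measurableI => //; rewrite -set_itvcy.
  + by apply: measurableI => //; rewrite -set_itvcy.
  rewrite muleC -EFinM -expr2.
  congr (_ * P _)%E; apply/seteqP; split => w /=; rewrite /D/=.
    by case=> -[? ?] /andP[? ?].
  by case=> -[? ->] [? ->].
- by apply: measurable_event; solve_meas.
Qed.

Lemma pr_pair (a b : R -> bool) :
  measurable_fun setT (a : measurableTypeR R -> bool) ->
  measurable_fun setT (b : measurableTypeR R -> bool) ->
  pr P (fun w => a (X w) && b (Y w)) = prR F a * prR F b.
Proof.
move=> ma mb; apply: EFin_inj; rewrite EFinM -!prE//.
  rewrite -XY; [|exact: measurable_event..].
  by congr (P _); apply/seteqP; split => w /= /andP.
by apply: measurable_and; [exact: (measurableT_comp ma mX)|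
  exact: (measurableT_comp mb mY)].
Qed.

(** Among pairs of nonnegative variables, [X + Y] exceeds [x] as soon as one of
    them does, and the events where [X] or [Y] does have total probability
    [2 p Fb x - Fb x ^ 2]. Subexponentiality says that [X + Y] exceeds [x] with
    probability [2 p Fb x + o(Fb x)], so nothing of order [Fb x] is left for the
    pairs with both variables at most [x]. *)
Lemma vanishing_pair_below :
  vanishing_wrt (tailr F)
    (fun x => pr P (fun w => [&& X w <= x, Y w <= x & x < X w + Y w])).
Proof.
have p0 := nonneg_mass_gt0.
pose N x := pr P (fun w => [&& 0 <= X w, 0 <= Y w & x < X w + Y w]).
pose Q x := pr P (fun w => [&& X w <= x, Y w <= x & x < X w + Y w]).
(* both variables are nonnegative in [Q x], as neither of them exceeds [x] *)
have QN x : 0 <= x -> Q x <= N x - 2 * p * tailr F x + tailr F x ^+ 2.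
  move=> x0.
  have mN : measurable_fun setT
    (fun w => [&& 0 <= X w, 0 <= Y w & x < X w + Y w]) by solve_meas.
  have mXx : measurable_fun setT (fun w => x < X w) by solve_meas.
  have mYx : measurable_fun setT (fun w => x < Y w) by solve_meas.
  (* split by whether [X] exceeds [x], then by whether [Y] does *)
  have := prID P mN mXx; rewrite -/(N x).
  have := prID P (measurable_and mN (measurable_neg mXx)) mYx.
  have := prID P (measurable_and (_ : measurable_fun setT (fun w => 0 <= X w)) mYx) mXx.
  move=> /(_ ltac:(solve_meas)).
  rewrite (pr_pair (measurable_ge 0) (measurable_gt x)) -/p -/(tailr F x).
  have : pr P (fun w => (x < X w) && (0 <= Y w)) <=
      pr P (fun w => [&& 0 <= X w, 0 <= Y w & x < X w + Y w] && (x < X w)).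
    by apply: le_pr => [||w /andP[xX Y0]]; [solve_meas..|]; lra.
  rewrite (pr_pair (measurable_gt x) (measurable_ge 0)) -/p -/(tailr F x).
  have : pr P (fun w => (0 <= X w) && (x < Y w) && (x < X w)) <=
      tailr F x ^+ 2.
    rewrite expr2 -pr_pair; [|exact: measurable_gt..].
    by apply: le_pr => [||w /andP[/andP[_ ->] ->]]; [solve_meas..|].
  have : pr P (fun w => (0 <= X w) && (x < Y w) && ~~ (x < X w)) <=
      pr P (fun w => [&& 0 <= X w, 0 <= Y w & x < X w + Y w] && ~~ (x < X w)
        && (x < Y w)).
    by apply: le_pr => [||w]; [solve_meas..|]; lra.
  have : Q x <= pr P (fun w => [&& 0 <= X w, 0 <= Y w & x < X w + Y w] && ~~ (x < X w)
        && ~~ (x < Y w)).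
    by apply: le_pr => [||w]; [solve_meas..|]; lra.
  lra.
have [_ [_ _]] := F_subexp.
move=> /fine_cvgP[_ /cvgrPdist_le lim2] e e0.
have e2 : 0 < e / 2 / p by rewrite !divr_gt0.
have eh : 0 < e / 2 by rewrite divr_gt0.
have := lim2 _ e2; have := @tailr_cvg0 _ eh.
have := @nbhs_pinfty_ge R 0 (num_real _).
apply: filterS3 => x x0 Fx; rewrite /= tail_convolution_cond_pos tail_cond_pos//.
have Fx0 := tailr_gt0 x.
rewrite inver gt_eqF ?divr_gt0//= -/(N x) -/(Q x).
have -> : N x / p ^+ 2 * (tailr F x / p)^-1 = N x / (p * tailr F x).
  by field; rewrite !gt_eqF.
rewrite ler_distlC => /andP[_].
rewrite ler_pdivrMr ?mulr_gt0// mulrA mulrDl divfK ?gt_eqF// => NFx.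
have := QN _ x0; rewrite expr2; nra.
Qed.

(** Long-tailedness. If [x - a < X <= x] and [a < Y <= x] then [X + Y] exceeds
    [x] although neither variable does, and the second condition has a
    probability bounded away from 0. *)
Lemma vanishing_tail_window (a : R) : 0 <= a ->
  vanishing_wrt (tailr F) (fun x => tailr F (x - a) - tailr F x).
Proof.
move=> a0; have Fa0 := tailr_gt0 a.
have c0 : 0 < 2 / tailr F a by rewrite divr_gt0.
apply: (vanishing_le _ (vanishingZ c0 vanishing_pair_below)).
have : 0 < tailr F a / 2 by rewrite divr_gt0.
move=> /tailr_cvg0; apply: filterS2 (@nbhs_pinfty_ge R a (num_real _)) => x ax Fxa.
rewrite mulrAC ler_pdivlMr//.
have : pr P (fun w => ((x - a < X w) && ~~ (x < X w)) &&
                      ((a < Y w) && ~~ (x < Y w))) <=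
    pr P (fun w => [&& X w <= x, Y w <= x & x < X w + Y w]).
  by apply: le_pr => [||w]; [solve_meas..|]; lra.
rewrite (pr_pair (a := fun z : R => (x - a < z) && ~~ (x < z))
  (b := fun z : R => (a < z) && ~~ (x < z))); last 2 first.
- exact: measurable_and (measurable_gt _) (measurable_neg (measurable_gt _)).
- exact: measurable_and (measurable_gt _) (measurable_neg (measurable_gt _)).
rewrite !tailr_window//; last by rewrite gerBl.
have : tailr F x <= tailr F (x - a) by apply: tailr_le; rewrite gerBl.
nra.
Qed.

End pair.
End subexponential_tail.

(** * Independence from the future *)

Section sequence.
Context {d : measure_display} {T : measurableType d} {R : realType}.
Variable P : probability T R.
Variable F : probability (measurableTypeR R) R.
Variable xi : nat -> {RV P >-> R}.
Variable tau : {RV P >-> nat}.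
Hypothesis xi_distr : forall (i : nat) (A : set R), measurable A ->
  distribution P (xi i) A = F A.
Hypothesis F_subexp : subexponential F.
Hypothesis tau_future : independent_of_future xi tau.

(** The sample space with the sigma-algebra of the past, so that closure of
    measurable functions under sums and maxima applies to the past as well. *)
Let pastT n := g_sigma_algebraType
  (\bigcup_(i in [set i | (i < n)%N]) g_sigma_algebra_preimage (xi i) `|`
   g_sigma_algebra_preimage (\1_[set w | (tau w <= n)%N] : T -> R)).

Lemma past_measurable_xi i n : (i < n)%N ->
  measurable_fun setT (xi i : pastT n -> R).
Proof.
move=> ni _ B mB; apply: sub_sigma_algebra; left; exists i => //.
by exists B.
Qed.

Lemma past_measurable_tau n :
  measurable_fun setT ((fun w => n < tau w)%N : pastT n -> bool).
Proof.
apply: (@measurable_fun_bool _ _ _ _ false).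
rewrite setTI; apply: sub_sigma_algebra; right.
exists [set 1%R]; first exact: measurable_set1.
rewrite setTI; apply/seteqP; split => w /=; rewrite indicE.
  case: (boolP (w \in _)) => [|_ /esym/eqP]; last by rewrite oner_eq0.
  by rewrite inE/= ltnNge => ->.
by move/negbT; rewrite -leqNgt => nw; rewrite mem_set.
Qed.

(** The source of independence for everything below; [f] will be an earlier
    variable, a sum of earlier positive parts, or the event [n < tau]. *)
Lemma past_future_independent {d'} {U : measurableType d'} n j (f : T -> U)
    (A : set R) (B : set U) : (n <= j)%N ->
  measurable_fun setT (f : pastT n -> U) -> measurable A -> measurable B ->
  P [set w | A (xi j w) /\ B (f w)] = (F A * P [set w | B (f w)])%E.
Proof.
move=> nj mf mA mB; rewrite muleC -(xi_distr j mA) /distribution /pushforward.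
rewrite -(@tau_future n).
- by congr (P _); apply/seteqP; split => w [].
- by have := mf measurableT B mB; rewrite setTI.
- apply: sub_sigma_algebra; exists j => //; exists A => //.
  by rewrite setTI.
Qed.

Lemma mxi i : measurable_fun setT (xi i). Proof. exact: measurable_funPT. Qed.

#[local] Hint Resolve mxi : core.

Lemma lawE i (A : set R) : measurable A -> P [set w | A (xi i w)] = F A.
Proof. by move=> mA; rewrite -(xi_distr i mA). Qed.

Lemma pr_xi i (a : R -> bool) :
  measurable_fun setT (a : measurableTypeR R -> bool) ->
  pr P (fun w => a (xi i w)) = prR F a.
Proof. by move=> /measurable_event ma; rewrite /pr -(lawE i ma). Qed.

Lemma pair_law i j : i != j -> forall A B : set R,
  measurable A -> measurable B ->
  P [set w | A (xi i w) /\ B (xi j w)] = (F A * F B)%E.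
Proof.
wlog ij : i j / (i < j)%N.
  move=> wlogij; rewrite neq_ltn => /orP[ij|ji] A B mA mB.
    by apply: wlogij => //; rewrite ltn_eqF.
  rewrite muleC -(wlogij j i)// ?ltn_eqF//.
  by congr (P _); apply/seteqP; split => w [].
move=> _ A B mA mB.
rewrite muleC -(lawE i mA).
rewrite -(past_future_independent (leqnn j) (past_measurable_xi ij) mB mA).
by congr (P _); apply/seteqP; split => w [].
Qed.

(** * Sums of positive parts without a big jump *)

Definition pos_sum n w : R := \sum_(i < n) Num.max (xi i w) 0.

Definition all_below n x w := all (fun i => xi i w <= x) (iota 0 n).

Lemma measurable_pos_sum n : measurable_fun setT (pos_sum n).
Proof. by apply: measurable_sum => i; apply: measurable_maxr. Qed.

Lemma measurable_all_below n x : measurable_fun setT (all_below n x).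
Proof. apply: measurable_all => i; solve_meas. Qed.

Lemma past_measurable_pos_sum n : measurable_fun setT (pos_sum n : pastT n -> R).
Proof.
apply: measurable_sum => i; apply: measurable_maxr; last exact: measurable_cst.
exact: past_measurable_xi.
Qed.

Lemma pos_sum_law n (A B : set R) : measurable A -> measurable B ->
  P [set w | A (xi n w) /\ B (pos_sum n w)] =
    (F A * P [set w | B (pos_sum n w)])%E.
Proof.
exact: past_future_independent (leqnn n) (@past_measurable_pos_sum n).
Qed.

Let Fb := tailr F.
Let jumpless_excess n x := pr P (fun w => all_below n x w && (x < pos_sum n w)).

Lemma prX i x : pr P (fun w => x < xi i w) = Fb x.
Proof. by rewrite (pr_xi i (measurable_gt x)). Qed.

Lemma prX_window i x y : x <= y ->
  pr P (fun w => (x < xi i w) && ~~ (y < xi i w)) = Fb x - Fb y.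
Proof.
move=> xy; rewrite -(tailr_window F xy).
rewrite (pr_xi i (a := fun z => (x < z) && ~~ (y < z)))//.
exact: measurable_and (measurable_gt _) (measurable_neg (measurable_gt _)).
Qed.

Lemma prX2 i j x y : i != j ->
  pr P (fun w => (x < xi i w) && (y < xi j w)) = Fb x * Fb y.
Proof.
move=> ij; rewrite (pr_pair (mxi i) (mxi j) (pair_law ij)
  (measurable_gt x) (measurable_gt y))//.
Qed.

Lemma pos_sum_tail_le n z :
  pr P (fun w => z < pos_sum n w) <= jumpless_excess n z + n%:R * Fb z.
Proof.
have mT := measurable_pos_sum n.
have mb := measurable_all_below n z.
apply: (@le_trans _ _ (jumpless_excess n z + pr P (fun w => ~~ all_below n z w))).
  by apply: pr_cover2 => [|||w ->]; [solve_meas..|rewrite andbT orbN].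
rewrite lerD2l.
apply: (@le_trans _ _ (\sum_(i <- iota 0 n) pr P (fun w => z < xi i w))).
  apply: pr_cover => [|i|w]; [solve_meas..|].
  rewrite /all_below -has_predC => /hasP[i si /=]; rewrite -ltNge => zi.
  by apply/hasP; exists i.
under eq_bigr do rewrite prX.
by rewrite big_const_seq count_predT size_iota iter_addr_0 mulr_natl.
Qed.

(** Near infinity the bound holds by negligibility of [jumpless_excess n], and on
    the rest of [0, +oo[ because [Fb] is bounded away from 0 there. *)
Lemma pos_sum_tail_dominated n : vanishing_wrt Fb (jumpless_excess n) ->
  exists2 C, 0 < C & forall z, 0 <= z ->
    pr P (fun w => z < pos_sum n w) <= C * Fb z.
Proof.
move=> /(_ 1 ltr01)[M [_ bM]]; pose C := 1 + n%:R + (Fb (M + 1))^-1.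
have FM := tailr_gt0 F_subexp (M + 1).
have n0 : 0 <= n%:R :> R by [].
have iF0 : 0 < (Fb (M + 1))^-1 by rewrite invr_gt0.
exists C; first by rewrite /C; lra.
move=> z z0; have Fz := tailr_gt0 F_subexp z; rewrite -/(Fb z) in Fz.
have [zM|Mz] := leP z (M + 1).
  have : 1 <= (Fb (M + 1))^-1 * Fb z.
    by rewrite ler_pdivlMl// mulr1 tailr_le.
  have : pr P (fun w => z < pos_sum n w) <= 1.
    by apply: pr_le1; have := measurable_pos_sum n; solve_meas.
  by rewrite /C; nra.
have := pos_sum_tail_le n z; have := bM z ltac:(lra).
by rewrite /C; nra.
Qed.

Lemma pos_sum_ge n i w : (i < n)%N -> xi i w <= pos_sum n w.
Proof.
move=> ni; rewrite /pos_sum (bigD1 (Ordinal ni))//=.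
rewrite (le_trans (_ : _ <= Num.max (xi i w) 0)) ?le_max ?lexx//.
by rewrite lerDl sumr_ge0// => j _; rewrite le_max lexx orbT.
Qed.

(** If no summand exceeds [x - a], the event is one of [jumpless_excess n (x - a)];
    otherwise that summand lies itself in the window, as it is at most the sum. *)
Lemma pr_pos_sum_window n a x : 0 <= a ->
  pr P (fun w => (x - a < pos_sum n w) && ~~ (x < pos_sum n w)) <=
    jumpless_excess n (x - a) + n%:R * (Fb (x - a) - Fb x).
Proof.
move=> a0; have mT := measurable_pos_sum n.
have mb := measurable_all_below n (x - a).
pose W i w := (x - a < xi i w) && ~~ (x < xi i w).
have mW i : measurable_fun setT (W i) by rewrite /W; solve_meas.
pose V w := has (W^~ w) (iota 0 n).
have mV : measurable_fun setT V by exact: measurable_has.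
apply: (@le_trans _ _ (jumpless_excess n (x - a) + pr P V)).
  apply: pr_cover2 => [|||w /andP[xT Tx]]; [solve_meas..|].
  rewrite xT andbT; have [//|/=] := boolP (all_below n (x - a) w).
  rewrite /all_below -has_predC => /hasP[i si /=]; rewrite -ltNge => xi_gt.
  apply/hasP; exists i => //; rewrite /W xi_gt/= -leNgt.
  apply: (le_trans (pos_sum_ge w (_ : i < n)%N)); last by rewrite leNgt.
  by move: si; rewrite mem_iota.
rewrite lerD2l; apply: (@le_trans _ _ (\sum_(i <- iota 0 n) pr P (W i))).
  exact: pr_cover.
under eq_bigr do rewrite prX_window ?gerBl//.
by rewrite big_const_seq count_predT size_iota iter_addr_0 mulr_natl.
Qed.

(** By induction on [n]. The level [a] separates the values of the new variable
    that are absorbed by long-tailedness of [F] from those for which the old sum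
    is replaced by a single variable. *)
Lemma vanishing_pos_sum_below n : vanishing_wrt Fb (jumpless_excess n).
Proof.
have F0 x : 0 <= Fb x by exact: tailr_ge0.
elim: n => [|n IHn].
  move=> e e0; near=> x; apply: (@le_trans _ _ 0); last by rewrite mulr_ge0// ltW.
  rewrite /jumpless_excess /pr (_ : [set _ | _] = set0) ?measure0//.
  apply/seteqP; split => w //=; rewrite /pos_sum big_ord0 ltNge.
  by rewrite (_ : 0 <= x)//; near: x; exact: nbhs_pinfty_ge.
have [C C0 TC] := pos_sum_tail_dominated IHn.
apply: vanishing_approx => e e0.
have [a a0 Fa] : exists2 a, 0 <= a & C * Fb a <= e.
  have : 0 < e / C by rewrite divr_gt0.
  move=> /(tailr_cvg0 F)[M [_ FM]]; exists (Num.max (M + 1) 0).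
    by rewrite le_max lexx orbT.
  rewrite mulrC -ler_pdivlMr//; apply: FM.
  by rewrite lt_max ltrDl ltr01.
pose key x := pr P (fun w => [&& xi 1%N w <= x, xi 0%N w <= x & x < xi 1%N w + xi 0%N w]).
have key0 : vanishing_wrt Fb key.
  exact: (vanishing_pair_below F_subexp (mxi 1) (mxi 0) (pair_law (isT : 1%N != 0%N))).
have window : vanishing_wrt Fb (fun x => Fb (x - a) - Fb x).
  exact: (vanishing_tail_window F_subexp (mxi 1) (mxi 0) (pair_law (isT : 1%N != 0%N))).
(* the coefficient [n%:R + 1] rather than [n%:R] keeps it positive for [n = 0] *)
exists (fun x => (jumpless_excess n x + (jumpless_excess n (x - a) +
    (n%:R + 1) * (Fb (x - a) - Fb x))) + C * key x).
  apply: vanishingD; last exact: vanishingZ.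
  apply: vanishingD => //; apply: vanishingD; last exact: vanishingZ.
  (* long tails turn negligibility with respect to [Fb (x - a)] into
     negligibility with respect to [Fb x] *)
  move=> r r0; have r2 : 0 < r / 2 by rewrite divr_gt0.
  have := near_pinfty_subr a (IHn _ r2); have := window 1 ltr01.
  apply: filterS2 => x; have := F0 x; have := F0 (x - a); nra.
near=> x.
have mT := measurable_pos_sum n.
have mb := measurable_all_below n x.
have mT1 := measurable_pos_sum n.+1.
have mb1 := measurable_all_below n.+1 x.
(* [E1]: the old sum is already too large; [E2]: the new variable is at most
   [a], so the old sum is close to [x]; [E3]: the new variable exceeds [a] *)
pose E1 w := all_below n x w && (x < pos_sum n w).
pose E2 w := (x - a < pos_sum n w) && ~~ (x < pos_sum n w).
pose E3 w := (a < xi n w <= x) && (x < xi n w + pos_sum n w).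
have mE1 : measurable_fun setT E1 by rewrite /E1; solve_meas.
have mE2 : measurable_fun setT E2 by rewrite /E2; solve_meas.
have mE3 : measurable_fun setT E3 by rewrite /E3; solve_meas.
have : jumpless_excess n.+1 x <= pr P E1 + (pr P E2 + pr P E3).
  apply: (@le_trans _ _ (pr P E1 + pr P (fun w => E2 w || E3 w))); last first.
    by rewrite lerD2l; apply: pr_cover2 => //; solve_meas.
  apply: pr_cover2 => [|||w]; [solve_meas..|].
  rewrite /all_below -addn1 iotaD all_cat/= andbT add0n => /andP[/andP[bn xnx]].
  rewrite /pos_sum addn1 big_ord_recr/= -/(pos_sum n w) /E1 /E2 /E3 /all_below bn xnx.
  have [//|Tx] := ltP x (pos_sum n w); rewrite /= !andbT.
  have [xna|axn] := leP (xi n w) a; rewrite /= ?orbF.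
    have : Num.max (xi n w) 0 <= a by rewrite ge_max xna.
    by lra.
  by rewrite max_l ?(le_trans a0 (ltW axn))// addrC => ->; rewrite orbT.
have : pr P E2 <= jumpless_excess n (x - a) + n%:R * (Fb (x - a) - Fb x).
  exact: pr_pos_sum_window.
have : pr P E3 <= C * pr P (fun w => (a < xi 1%N w <= x) && (x < xi 1%N w + xi 0%N w)).
  apply: (convolution_tail_le (F := F)) => //; first exact: ltW.
  - exact: pos_sum_law.
  - move=> A B mA mB; rewrite (pair_law (isT : 1%N != 0%N))//.
    by rewrite (lawE 0 mB).
  - by move=> z /TC; rewrite (prX 0).
have : pr P (fun w => (a < xi 1%N w <= x) && (x < xi 1%N w + xi 0%N w)) <=
    Fb a * Fb x + key x.
  rewrite -(prX2 a x (isT : 1%N != 0%N)).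
  by apply: pr_cover2 => [|||w]; [solve_meas..|]; lra.
have : 0 <= Fb (x - a) - Fb x by rewrite subr_ge0 tailr_le// gerBl.
have -> : pr P E1 = jumpless_excess n x by [].
have := F0 x; nra.
Unshelve. all: by end_near. Qed.

(** * The randomly stopped sum *)

Lemma measurable_tau_gt i : measurable_fun setT (fun w => (i < tau w)%N).
Proof.
have mi : measurable_fun setT (fun m : nat => (i < m)%N) by [].
exact: (measurableT_comp mi (measurable_funPT tau)).
Qed.

Lemma measurable_partial_sum n : measurable_fun setT (partial_sum xi n).
Proof. exact: measurable_sum. Qed.

Lemma measurable_stopped_sum :
  measurable_fun setT (fun w => partial_sum xi (tau w) w).
Proof.
move=> _ B mB; rewrite setTI.
rewrite (_ : _ @^-1` _ = \bigcup_n (tau @^-1` [set n] `&` partial_sum xi n @^-1` B)).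
  apply: bigcup_measurable => n _; apply: measurableI.
    by rewrite -[X in measurable X]setTI; exact: (measurable_funPT tau).
  by have := measurable_partial_sum n measurableT mB; rewrite setTI.
apply/seteqP; split => w /=; first by exists (tau w).
by case=> n _ [/= <-].
Qed.

Lemma pr_tau_jump i x :
  pr P (fun w => (x < xi i w) && (i < tau w)%N) =
  pr P (fun w => (i < tau w)%N) * Fb x.
Proof.
have mt := measurable_tau_gt i.
apply: EFin_inj; rewrite EFinM -(prE P mt) -[LHS]prE; last by solve_meas.
have mx := measurable_event (measurable_gt (R := R) x).
rewrite /Fb /tailr muleC -prE; last exact: measurable_gt.
rewrite -(past_future_independent (leqnn i) (@past_measurable_tau i) mx
  (_ : measurable [set true]))//.
by congr (P _); apply/seteqP; split => w /= /andP.
Qed.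

Lemma sum_ltn_indicator n m : (\sum_(i < n) (i < m)%N)%N = minn n m.
Proof.
elim: n => [|n IHn]; first by rewrite big_ord0 min0n.
rewrite big_ord_recr/= IHn; have [nm|] := boolP (n < m)%N.
  by rewrite (minn_idPl (ltnW nm)) (minn_idPl nm) addn1.
by rewrite -leqNgt => nm; rewrite (minn_idPr nm) (minn_idPr (leqW nm)) addn0.
Qed.

Section bounded.
Variable N : nat.
Hypothesis tauN : P [set w | (tau w <= N)%N] = 1%E.

Lemma pr_tau_gtN : pr P (fun w => (N < tau w)%N) = 0.
Proof.
have mt := measurable_tau_gt N.
have := pr_neg P (measurable_neg mt).
rewrite (eq_pr P (G := fun w => (N < tau w)%N)); last by move=> w; rewrite negbK.
move=> ->; rewrite /pr (_ : [set _ | _] = [set w | (tau w <= N)%N]).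
  by rewrite tauN subrr.
by apply/seteqP; split => w /=; rewrite -leqNgt.
Qed.

Lemma expectation_tau : ('E_P[fun w => (tau w)%:R])%E =
  (\sum_(i < N) pr P (fun w => (i < tau w)%N))%:E.
Proof.
rewrite unlock.
transitivity (\int[P]_w (\sum_(i < N) (\1_[set w | (i < tau w)%N] w)%:E))%E.
  apply: ae_eq_integral => //.
  - apply: measurableT_comp => //.
    have mc : measurable_fun setT (fun m : nat => m%:R : R) by [].
    exact: (measurableT_comp mc (measurable_funPT tau)).
  - apply: emeasurable_sum => i; apply: measurableT_comp => //.
    apply: measurable_indic; exact/measurable_event/measurable_tau_gt.
  - exists [set w | (N < tau w)%N]; split.
    + exact/measurable_event/measurable_tau_gt.
    + by have := prE P (measurable_tau_gt N); rewrite pr_tau_gtN.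
    + move=> w /=; rewrite ltnNge => nE; apply/negP => tN; apply: nE => _.
      rewrite sumEFin; congr EFin.
      under eq_bigr do rewrite indicE.
      rewrite -natr_sum; congr _%:R; rewrite -[LHS](minn_idPr tN) -sum_ltn_indicator.
      by apply: eq_bigr => i _; congr nat_of_bool; apply/idP/idP; rewrite inE.
rewrite ge0_integral_sum//; last first.
  move=> i; apply: measurableT_comp => //.
  apply: measurable_indic; exact/measurable_event/measurable_tau_gt.
rewrite -sumEFin; apply: eq_bigr => i _.
rewrite integral_indic ?setIT//; last exact/measurable_event/measurable_tau_gt.
exact: (prE P (measurable_tau_gt i)).
Qed.

Let S_tau w := partial_sum xi (tau w) w.
Let tau_tail i := pr P (fun w => (i < tau w)%N).

#[local] Hint Resolve measurable_tau_gt measurable_stopped_sum : core.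

Lemma partial_sum_le_pos_sum n w : partial_sum xi n w <= pos_sum n w.
Proof. by apply: ler_sum => i _; rewrite le_max lexx. Qed.

(** Either one of the summands used by the stopped sum exceeds [x], or, with [n]
    the value of [tau], the first [n] positive parts add up to more than [x]
    without a big jump. *)
Lemma stopped_tail_le x :
  pr P (fun w => x < S_tau w) <=
    \sum_(i < N) tau_tail i * Fb x + \sum_(n < N.+1) jumpless_excess n x.
Proof.
have mS : measurable_fun setT S_tau by exact: measurable_stopped_sum.
have mt i : measurable_fun setT (fun w => (i < tau w)%N) by [].
have mT n := measurable_pos_sum n.
have mb n := measurable_all_below n x.
pose J w := has (fun i => (x < xi i w) && (i < tau w)%N) (iota 0 N).
have mJ : measurable_fun setT J by rewrite /J; solve_meas.
pose B w := has (fun n => all_below n x w && (x < pos_sum n w)) (iota 0 N.+1).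
have mB : measurable_fun setT B by rewrite /B; solve_meas.
have covJ : pr P J <= \sum_(i < N) tau_tail i * Fb x.
  under eq_bigr do rewrite -pr_tau_jump.
  rewrite -(big_mkord xpredT (fun i => pr P (fun w => (x < xi i w) && (i < tau w)%N))).
  rewrite /index_iota subn0.
  by apply: pr_cover => [|i|w]; [solve_meas..|].
have covB : pr P B <= \sum_(n < N.+1) jumpless_excess n x.
  rewrite -(big_mkord xpredT (fun n => jumpless_excess n x)) /index_iota subn0.
  by apply: pr_cover => [|i|w]; [solve_meas..|].
have : pr P (fun w => x < S_tau w) <= pr P J + pr P (fun w => B w || (N < tau w)%N).
  apply: pr_cover2 => [|||w xS]; [solve_meas..|].
  have [tN|tN] := ltnP N (tau w); first by rewrite !orbT.
  have [//|/= J0] := boolP (J w); rewrite orbF; apply/hasP; exists (tau w).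
    by rewrite mem_iota.
  rewrite (lt_le_trans xS (partial_sum_le_pos_sum _ _)) andbT.
  apply/allP => i; rewrite mem_iota => /= it; rewrite leNgt.
  apply: contra J0 => xxi; apply/hasP; exists i; last by rewrite xxi.
  by rewrite mem_iota/= (leq_trans it).
have : pr P (fun w => B w || (N < tau w)%N) <= pr P B + pr P (fun w => (N < tau w)%N).
  by apply: pr_cover2 => [|||w]; solve_meas.
rewrite pr_tau_gtN; lra.
Qed.

Lemma partial_sum_ge i n a w : (i < n <= N)%N -> 0 <= a ->
  (forall j, j != i -> (j < N)%N -> - a <= xi j w) ->
  xi i w - N%:R * a <= partial_sum xi n w.
Proof.
move=> /andP[ni nN] a0 xia.
rewrite /partial_sum (bigD1 (Ordinal ni))//= lerD2l.
apply: (@le_trans _ _ (\sum_(j < n | j != Ordinal ni) - a)).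
  rewrite sumr_const -[leRHS]mulr_natl mulrN lerN2 ler_wpM2r//.
  rewrite ler_nat (leq_trans (max_card _))// card_ord//.
apply: ler_sum => j ji; apply: xia => //.
by rewrite (leq_trans (ltn_ord j)).
Qed.

(** If [xi i] jumps above [x + N a] before [tau] and all other variables are at
    least [- a], the stopped sum exceeds [x]. The three error terms stand for
    two simultaneous jumps, for a jump that ends in the window above [x], and
    for a jump together with a variable below [- a]. *)
Lemma stopped_tail_ge a x : 0 <= a ->
  \sum_(i < N) tau_tail i * Fb x <= pr P (fun w => x < S_tau w) +
    \sum_(j < N) \sum_(i < j) Fb x * Fb x +
    \sum_(i < N) (Fb x - Fb (x + N%:R * a)) +
    \sum_(i < N) \sum_(j < N)
      Fb x * prR F (fun y : R => y < - a).
Proof.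
move=> a0.
have mS : measurable_fun setT S_tau by exact: measurable_stopped_sum.
have mt i : measurable_fun setT (fun w => (i < tau w)%N) by [].
pose M i w := (x < xi i w) && (i < tau w)%N.
have mM i : measurable_fun setT (M i) by rewrite /M; solve_meas.
pose J w := has (M^~ w) (iota 0 N).
have mJ : measurable_fun setT J by rewrite /J; solve_meas.
have MJ i w : (i < N)%N -> M i w -> J w.
  by move=> iN Miw; apply/hasP; exists i; rewrite ?mem_iota.
have bonf := pr_bonferroni P mJ mM MJ.
(* one family for both ways in which a jump of [xi i] can fail to lift the sum
   above [x]: the diagonal carries the window *)
pose W i j w := if i == j then (x < xi i w) && ~~ (x + N%:R * a < xi i w)
  else (x < xi i w) && (xi j w < - a).
have mW i j : measurable_fun setT (W i j).
  by rewrite /W; case: eqP => _; solve_meas.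
pose V w := has (fun i => has (fun j => W i j w) (iota 0 N)) (iota 0 N).
have mV : measurable_fun setT V by rewrite /V; solve_meas.
have covV : pr P V <= \sum_(i < N) \sum_(j < N) pr P (W i j).
  rewrite -(big_mkord xpredT (fun i => \sum_(j < N) pr P (W i j))).
  rewrite /index_iota subn0.
  apply: (@le_trans _ _ (\sum_(i <- iota 0 N)
      pr P (fun w => has (fun j => W i j w) (iota 0 N)))).
    by apply: pr_cover => [|i|w]; [solve_meas..|].
  apply: ler_sum => i _.
  rewrite -(big_mkord xpredT (fun j => pr P (W i j))) /index_iota subn0.
  by apply: pr_cover => [|j|w]; [solve_meas..|].
have covJ : pr P J <= pr P (fun w => x < S_tau w) +
    (pr P V + pr P (fun w => (N < tau w)%N)).
  apply: (@le_trans _ _ (pr P (fun w => x < S_tau w) +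
      pr P (fun w => V w || (N < tau w)%N))).
    apply: pr_cover2 => [|||w]; [solve_meas..|].
    move=> /hasP[i]; rewrite mem_iota/= add0n => iN /andP[xxi it].
    have [tN|tN] := ltnP N (tau w); first by rewrite !orbT.
    rewrite orbF; have [//|/= V0] := boolP (V w); last rewrite orbF.
      by rewrite orbT.
    have nW j : (j < N)%N -> ~~ W i j w.
      move=> jN; apply: contra V0 => Wij.
      by apply/hasP; exists i; rewrite ?mem_iota//; apply/hasP; exists j;
        rewrite ?mem_iota.
    have := nW i iN; rewrite /W eqxx xxi/= negbK => xiN.
    apply: (lt_le_trans (_ : x < xi i w - N%:R * a)); first by rewrite ltrBrDr.
    apply: partial_sum_ge => //; first by rewrite it.
    move=> j ji jN; have := nW j jN; rewrite /W eq_sym (negbTE ji) xxi/=.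
    by rewrite -leNgt.
  by rewrite lerD2l; apply: pr_cover2 => [|||w]; solve_meas.
have WE : \sum_(i < N) \sum_(j < N) pr P (W i j) <=
    \sum_(i < N) (Fb x - Fb (x + N%:R * a)) +
    \sum_(i < N) \sum_(j < N)
      Fb x * prR F (fun y : R => y < - a).
  rewrite -big_split; apply: ler_sum => i _ /=.
  have xN : x <= x + N%:R * a by rewrite lerDl mulr_ge0.
  rewrite (bigD1 i)//= [X in X + _](_ : _ = Fb x - Fb (x + N%:R * a)); last first.
    rewrite -(prX_window i xN); apply: eq_pr => w.
    by rewrite /W eqxx.
  rewrite lerD2l [leRHS](bigD1 i)//=.
  apply: (le_trans (ler_sum _ (G := fun=> Fb x *
    prR F (fun y : R => y < - a)) _)); last first.
    by rewrite lerDr mulr_ge0 ?pr_ge0 ?tailr_ge0.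
  move=> j ji; have ij : i != j :> nat by rewrite eq_sym.
  rewrite -(pr_pair (mxi i) (mxi j) (pair_law ij) (measurable_gt x)); last first.
    by apply: measurable_fun_ltr; [exact: measurable_id|exact: measurable_cst].
  by rewrite (eq_pr P (G := fun w => (x < xi i w) && (xi j w < - a)))// => w;
    rewrite /W (negbTE ij).
have ME : \sum_(j < N) \sum_(i < j) pr P (fun w => M i w && M j w) <=
    \sum_(j < N) \sum_(i < j) Fb x * Fb x.
  apply: ler_sum => j _; apply: ler_sum => i _.
  have ij : i != j :> nat by rewrite ltn_eqF.
  rewrite -(prX2 x x ij).
  by apply: le_pr => [||w /andP[/andP[-> _] /andP[-> _]]]; [rewrite /M; solve_meas..|].
have ->: \sum_(i < N) tau_tail i * Fb x = \sum_(i < N) pr P (M i).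
  by apply: eq_bigr => i _; rewrite -pr_tau_jump.
move: bonf covJ covV WE ME; rewrite pr_tau_gtN; lra.
Qed.

Lemma stopped_tail_upper :
  vanishing_wrt Fb
    (fun x => pr P (fun w => x < S_tau w) - (\sum_(i < N) tau_tail i) * Fb x).
Proof.
apply: (vanishing_le (h := fun x => \sum_(n < N.+1) jumpless_excess n x)).
  by near=> x; rewrite lerBlDl big_distrl/=; exact: stopped_tail_le.
apply: vanishing_sum => [x|i]; [exact: tailr_ge0|exact: vanishing_pos_sum_below].
Unshelve. all: by end_near. Qed.

Lemma stopped_tail_lower :
  vanishing_wrt Fb
    (fun x => (\sum_(i < N) tau_tail i) * Fb x - pr P (fun w => x < S_tau w)).
Proof.
have F0 x : 0 <= Fb x by exact: tailr_ge0.
apply: vanishing_approx => e e0.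
have [a a0 La] : exists2 a, 0 <= a & N%:R * N%:R *
    prR F (fun y : R => y < - a) <= e.
  have N1 : 0 < N%:R * N%:R + 1 :> R by rewrite ltr_wpDl// mulr_ge0.
  have e1 : 0 < e / (N%:R * N%:R + 1) by rewrite divr_gt0.
  (* one more than the number of terms, as [N] may be 0 *)
  have [a a0 La] := left_tail_small F e1; exists a => //.
  move: La; rewrite ler_pdivlMr//.
  have := pr_ge0 F (fun y : R => y < - a).
  move: (N%:R * N%:R : R) (pr _ _) => u v; lra.
have Na0 : 0 <= N%:R * a by rewrite mulr_ge0.
exists (fun x => \sum_(j < N) \sum_(i < j) Fb x * Fb x +
    \sum_(i < N) (Fb x - Fb (x + N%:R * a))).
  apply: vanishingD.
    do 2![apply: vanishing_sum => // ?].
    move=> r r0; have := tailr_cvg0 F r0; apply: filterS => x Fx.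
    by rewrite ler_wpM2r.
  apply: vanishing_sum => // _ r r0.
  have := vanishing_tail_window F_subexp (mxi 1) (mxi 0)
    (pair_law (isT : 1%N != 0%N)) Na0 r0.
  move=> /(near_pinfty_subr (- (N%:R * a))); apply: filterS => x.
  rewrite opprK addrK => /le_trans; apply.
  by apply: ler_wpM2l; [exact: ltW|apply: tailr_le; rewrite lerDl].
near=> x.
rewrite lerBlDl big_distrl/=.
apply: (le_trans (stopped_tail_ge x a0)).
set L := prR F _ in La *.
have -> : \sum_(i < N) \sum_(j < N) Fb x * L = N%:R * N%:R * L * Fb x.
  by rewrite !sumr_const !card_ord -mulrnA -[LHS]mulr_natl natrM; ring.
have := ler_wpM2r (F0 x) La.
set A := \sum_(j < N) _; set B := \sum_(i < N) _.
lra.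
Unshelve. all: by end_near. Qed.

End bounded.
End sequence.

Local Open Scope ereal_scope.

Theorem theorem9 (d : measure_display) (T : measurableType d) (R : realType)
    (P : probability T R) (F : probability (measurableTypeR R) R)
    (xi : nat -> {RV P >-> R}) (tau : {RV P >-> nat})
    (xi_indep : mutually_independent xi)
    (xi_distr : forall (i : nat) (A : set R), measurable A ->
       distribution P (xi i) A = F A)
    (F_subexp : subexponential F)
    (tau_future : independent_of_future xi tau)
    (tau_bounded : exists N : nat, P [set w | (tau w <= N)%N] = 1) :
  P [set w | (x < partial_sum xi (tau w) w)%R] / tail F x @[x --> +oo%R]
    --> 'E_P[fun w => (tau w)%:R].
Proof.
have [N tauN] := tau_bounded; rewrite (expectation_tau tauN).
set m := (\sum_(i < N) _)%R.
pose p x := pr P (fun w => x < partial_sum xi (tau w) w)%R.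
have ratioE x : P [set w | (x < partial_sum xi (tau w) w)%R] / tail F x =
    (p x / tailr F x)%:E.
  rewrite tailrE inver gt_eqF ?(tailr_gt0 F_subexp)// EFinM; congr (_ * _).
  have mS := measurable_stopped_sum xi tau.
  by apply: prE; apply: measurable_fun_ltr; [exact: measurable_cst|].
under eq_fun do rewrite ratioE.
apply/fine_cvgP; split; first exact: nearW.
apply/cvgrPdist_le => e e0.
have := stopped_tail_lower xi_distr F_subexp tau_future tauN e0.
have := stopped_tail_upper xi_distr F_subexp tau_future tauN e0.
apply: filterS2 => x; rewrite -/m -/(p x) /= => upper lower.
have F0 := tailr_gt0 F_subexp x.
rewrite ler_distlC ler_pdivlMr// ler_pdivrMr//.
by apply/andP; split; lra.
Qed.
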